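(* Let $n\ge2$ and let $\mu$ be a probability measure with compact support on $\mathbb{R}^n$. If $\psi\in\mathrm{Conv}_{\mathrm c}(\mathbb{R}^n)$ is such that $r(\psi)>R_\mu$, then there exists $\vartheta_o\in \mathrm{SO}(n)$ such that $$\Phi_{\mathrm{avg}}(\psi\circ\vartheta_o^{-1},\mu)=\min_{\vartheta\in \mathrm{SO}(n)}\Phi_{\mathrm{avg}}(\psi\circ\vartheta^{-1},\mu)\le\Phi_{\mathrm{avg}}(\psi_{\mathrm{rot}},\mu).$$ For $n=1$, the same statement holds with $\mathrm{O}(1)=\{\pm1\}$ in place of $\mathrm{SO}(1)$.
   Context: $\mathrm{Conv}_{\mathrm c}(\mathbb{R}^n)$ is the set of convex functions $\psi\colon\mathbb{R}^n\to(-\infty,\infty]$ that are proper ($\psi\not\equiv\infty$), lower semicontinuous, and coercive ($\lim_{|x|\to\infty}\psi(x)=\infty$). Legendre--Fenchel transform: $\mathcal{L}\psi(x)=\sup_{y\in\mathbb{R}^n}(\langle x,y\rangle-\psi(y))$; $\mathrm{dom}(\varphi)=\{x:\varphi(x)<\infty\}$. $B_n$ is the closed Euclidean unit ball, and $r(\psi)=\sup\{r\ge0: rB_n\subseteq\mathrm{dom}(\mathcal{L}\psi)\}\in(0,\infty]$. For a (Borel) probability measure $\mu$ on $\mathbb{R}^n$ with compact support $\mathrm{supp}(\mu)$ (the complement of the largest open $\mu$-null set), $R_\mu=\sup_{y\in\mathrm{supp}(\mu)}|y|\in[0,\infty)$. For $\psi\in\mathrm{Conv}_{\mathrm c}(\mathbb{R}^n)$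 with $\mathrm{supp}(\mu)\subseteq\mathrm{dom}(\mathcal{L}\psi)$, $$\Phi_{\mathrm{avg}}(\psi,\mu)=\int_{\mathbb{R}^n}\mathcal{L}\psi(y)\,\mathrm{d}\mu(y).$$ The condition $\mathrm{supp}(\mu)\subseteq\mathrm{dom}(\mathcal{L}\psi)$ holds in particular when $r(\psi)>R_\mu$. Rotational epi-symmetrization: for $n\ge2$, $\psi_{\mathrm{rot}}$ is the unique function in $\mathrm{Conv}_{\mathrm c}(\mathbb{R}^n)$ with $\mathcal{L}\psi_{\mathrm{rot}}(x)=\int_{\mathrm{SO}(n)}\mathcal{L}\psi(\vartheta^{-1}x)\,\mathrm{d}\vartheta$ for all $x$ (Haar probability measure on $\mathrm{SO}(n)$). For $n=1$, $\psi_{\mathrm{rot}}(x)=\tfrac12\,(\psi\,\square\,\psi^-)(2x)$, where $\psi^-(x)=\psi(-x)$ and $(\psi_1\,\square\,\psi_2)(x)=\inf_{y}(\psi_1(x-y)+\psi_2(y))$. *)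

(* Defs.v *)
From HB Require Import structures.
From mathcomp Require Export all_boot all_order all_algebra.
From mathcomp Require Export all_classical all_reals all_analysis.

Set Implicit Arguments.
Unset Strict Implicit.
Unset Printing Implicit Defensive.

Import Order.TTheory GRing.Theory Num.Theory.
Import numFieldTopology.Exports numFieldNormedType.Exports.

Local Open Scope classical_set_scope.
Local Open Scope ring_scope.
Local Open Scope ereal_scope.

(* The topology on matrices is the product topology, so this is the usual
   Borel sigma-algebra of 'cV[R]_n (that is, R^n) and of 'M[R]_n. *)
Notation borel T := (g_sigma_algebraType (@open T)).

Section Defs.
Context {R : realType}.

Section Euclidean.
Context {n : nat}.
Implicit Types (x y : 'cV[R]_n) (f psi : 'cV[R]_n -> \bar R).

Definition dotv x y : R := (\sum_(i < n) x i ord0 * y i ord0)%R.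

(* The library norm on matrices is the sup norm; this is the Euclidean one. *)
Definition enorm x : R := Num.sqrt (dotv x x).

Definition eball (r : R) : set 'cV[R]_n := [set x | (enorm x <= r)%R].

Definition convex_fun f : Prop :=
  forall x y (t : R), (0 < t < 1)%R ->
    f (t *: x + (1 - t) *: y)%R <= t%:E * f x + (1 - t)%:E * f y.

Definition proper_fun f : Prop :=
  (forall x, -oo < f x) /\ (exists x, f x < +oo).

Definition coercive f : Prop :=
  forall A : R, exists B : R, forall x, (B < enorm x)%R -> A%:E < f x.

Definition Conv_c : set ('cV[R]_n -> \bar R) :=
  [set psi | [/\ convex_fun psi, proper_fun psi, lower_semicontinuous psi
               & coercive psi]].

Definition legendre psi x : \bar R :=
  ereal_sup [set (dotv x y)%:E - psi y | y in [set: 'cV[R]_n]].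

Definition edom f : set 'cV[R]_n := [set x | f x < +oo].

Definition dom_radius psi : \bar R :=
  ereal_sup [set r%:E | r in [set r : R | (0 <= r)%R /\
                                eball r `<=` edom (legendre psi)]].

Definition infconv (psi1 psi2 : 'cV[R]_n -> \bar R) x : \bar R :=
  ereal_inf [set psi1 (x - y)%R + psi2 y | y in [set: 'cV[R]_n]].

(* psi o theta^-1 *)
Definition rotate_fun (theta : 'M[R]_n) psi : 'cV[R]_n -> \bar R :=
  fun x => psi (invmx theta *m x).

Definition supp_measure (mu : probability (borel 'cV[R]_n) R) : set 'cV[R]_n :=
  ~` \bigcup_(U in [set U : set 'cV[R]_n | open U /\ mu U = 0]) U.

Definition supp_radius (mu : probability (borel 'cV[R]_n) R) : \bar R :=
  ereal_sup [set (enorm y)%:E | y in supp_measure mu].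

Definition Phi_avg psi (mu : probability (borel 'cV[R]_n) R) : \bar R :=
  \int[mu]_y legendre psi y.

End Euclidean.

Definition O_ (n : nat) : set 'M[R]_n :=
  [set theta | theta^T *m theta = 1%:M]%R.
Arguments O_ : clear implicits.

Definition SO_ (n : nat) : set 'M[R]_n :=
  [set theta | O_ n theta /\ (\det theta = 1)%R].
Arguments SO_ : clear implicits.

(* The Haar probability measure of SO(n), seen as a Borel measure on all
   n x n matrices that is carried by SO(n). *)
Definition is_haar_SO (n : nat) (nu : probability (borel 'M[R]_n) R) : Prop :=
  nu (SO_ n) = 1 /\
  forall (theta : 'M[R]_n) (A : set (borel 'M[R]_n)),
    SO_ n theta -> measurable A -> nu (mulmx theta @^-1` A) = nu A.

(* Since psi = L (L psi) on Conv_c, at most one phi satisfies this, namely the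
   rotational epi-symmetrization of psi when nu is the Haar measure. *)
Definition is_epi_rot (n : nat) (nu : probability (borel 'M[R]_n) R)
    (psi phi : 'cV[R]_n -> \bar R) : Prop :=
  Conv_c phi /\
  forall x, legendre phi x =
    \int[nu]_(theta in SO_ n) legendre psi (invmx theta *m x).

Definition epi_rot1 (psi : 'cV[R]_1 -> \bar R) : 'cV[R]_1 -> \bar R :=
  fun x => (2^-1)%:E * infconv psi (fun z => psi (- z)%R) (2%:R *: x)%R.

End Defs.

Arguments O_ {R} n.
Arguments SO_ {R} n.

(* Main.v *)
Require Import Defs.
From mathcomp Require Import lra measurable_realfun.
Set Implicit Arguments.
Unset Strict Implicit.
Unset Printing Implicit Defensive.
Import Order.TTheory GRing.Theory Num.Theory.
Import numFieldTopology.Exports numFieldNormedType.Exports.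
Local Open Scope classical_set_scope.
Local Open Scope ring_scope.
Local Open Scope ereal_scope.

(** Write u for the Legendre transform of psi and theta^T for the inverse of an
    orthogonal matrix theta.  Rotating psi rotates u, so
    Phi_avg (psi o theta^-1, mu) is the integral over mu of u (theta^T y).

    Existence of a minimizer: u is lower semicontinuous, being a supremum of
    affine functions, and it is bounded below by some -c on the orthogonal orbit
    of the support of mu, because it lies above one affine function and
    orthogonal matrices preserve the Euclidean norm
    ([exists_orbit_bound]).  Fatou's lemma then makes
    theta |-> Phi_avg (psi o theta^-1, mu) lower semicontinuous
    ([lsc_integral]), and such a function attains its minimum on the compact
    group ([lsc_compact_min]).

    Comparison with the symmetrization: a minimum is at most an average.  By
    Tonelli, the average of Phi_avg (psi o theta^-1, mu) over theta is the
    integral over mu of the average of u (theta^T y) over theta, and the latter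
    average is the Legendre transform of the symmetrization
    ([avg_rotation_le_Phi_avg]).  In dimension one the average has the two terms
    u y and u (- y), and half of their sum is at most the Legendre transform of
    the epi-symmetrization ([legendre_epi_rot1_ge],
    [avg_reflection_le_Phi_avg]).

    All integrals may be infinite.  To integrate only nonnegative functions, u is
    replaced by the positive part w of u + c, which is defined everywhere, is
    still lower semicontinuous, and satisfies
    Phi_avg (psi o theta^-1, mu) = J theta - c, where J theta is the integral of
    w (theta^T y) over mu ([integral_shift_pos], [Phi_avg_rotate_fun]). *)

(** * Topology of matrix spaces *)

Section MatrixTopology.
Context {R : realType} {m n : nat}.

Lemma nbhs_mxP (M : 'M[R]_(m, n)) (A : set 'M[R]_(m, n)) :
  nbhs M A <-> exists2 e : R, (0 < e)%R &
    forall N : 'M[R]_(m, n), (forall i j, `|M i j - N i j| < e)%R -> A N.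
Proof.
split=> [/nbhs_ballP[e e0 eA]|[e e0 eA]].
  by exists e => // N MN; apply: eA; split.
by apply/nbhs_ballP; exists e => //= N [_ MN]; exact: eA.
Qed.

Lemma continuous_mx (T : topologicalType) (f : T -> 'M[R]_(m, n)) :
  (forall i j, continuous (fun t => f t i j)) -> continuous f.
Proof.
move=> cf t A /nbhs_mxP[e e0 eA]; rewrite nbhs_filterE.
have : \forall s \near t, forall i j, (`|f t i j - f s i j| < e)%R.
  apply: filter_forall => i; apply: filter_forall => j.
  by have /cvgr_dist_lt := cf i j t; exact.
by apply: filterS => s; exact: eA.
Qed.

(** The boxes with rational center and side 2 / (k + 1), indexed by a countable
    type, form a base of the topology. *)
Definition rat_box (p : 'M[rat]_(m, n) * nat) : set 'M[R]_(m, n) :=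
  [set M | forall i j, (`|ratr (p.1 i j) - M i j| < p.2.+1%:R^-1)%R].

Lemma open_rat_box p : open (rat_box p).
Proof.
rewrite openE => M /= pM; rewrite /interior.
suff : \forall N \near M, forall i j,
  (`|ratr (p.1 i j) - (N : 'M[R]_(m, n)) i j| < p.2.+1%:R^-1)%R by [].
have F : Filter (nbhs M) by exact: nbhs_filter.
apply: (@filter_forall _ _ _ _ F) => i; apply: (@filter_forall _ _ _ _ F) => j.
pose C : set R := [set x | `|ratr (p.1 i j) - x| < p.2.+1%:R^-1]%R.
apply: (@coord_continuous R m n i j M C); apply: open_nbhs_nbhs.
split; last exact: pM.
rewrite (_ : C = ball (ratr (p.1 i j) : R) p.2.+1%:R^-1)%R //.
exact: ball_open.
Qed.

Lemma nbhs_rat_box (M : 'M[R]_(m, n)) (U : set 'M[R]_(m, n)) : nbhs M U ->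
  exists p, rat_box p M /\ rat_box p `<=` U.
Proof.
move=> /nbhs_mxP[e e0 eU].
have e20 : (0 < e / 2)%R by rewrite divr_gt0.
pose k := Num.truncn (e / 2)^-1.
have k0 : (0 < k.+1%:R^-1 :> R)%R by rewrite invr_gt0.
have ke : (k.+1%:R^-1 < e / 2)%R.
  by rewrite -[ltRHS]invrK ltf_pV2 ?posrE ?invr_gt0// truncnS_gt.
have ex i j : exists q : rat, (`|ratr q - M i j| < k.+1%:R^-1)%R.
  have [|q] := @rat_in_itvoo R (M i j - k.+1%:R^-1) (M i j + k.+1%:R^-1).
    by rewrite ltrD2l gt0_cp.
  by rewrite in_itv/= -ltr_distl => qM; exists q.
exists (\matrix_(i, j) sval (cid (ex i j)), k); split=> [i j|N pN] /=.
  by rewrite mxE; case: cid.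
apply: eU => i j; have := pN i j; rewrite /= mxE; case: cid => q /= qM qN.
rewrite (le_lt_trans (ler_distD (ratr q) _ _))// distrC.
by rewrite [ltRHS](splitr e) ltrD// ?(lt_trans qM)// (lt_trans qN).
Qed.

Lemma open_bigcup_rat_box (U : set 'M[R]_(m, n)) : open U ->
  U = \bigcup_(p in [set p | rat_box p `<=` U]) rat_box p.
Proof.
rewrite openE => oU; apply/seteqP; split=> [M /oU /nbhs_rat_box[p [pM pU]]|].
  by exists p.
by move=> M [p pU /pU].
Qed.

(** [vec_mx] maps a cube of row vectors, compact by Tychonoff, onto a compact set
    that contains A. *)
Lemma bounded_entries_compact (b : R) (A : set 'M[R]_(m, n)) : closed A ->
  (forall M, A M -> forall i j, (`|M i j| <= b)%R) -> compact A.
Proof.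
move=> cA bA.
pose Q : set 'rV[R]_(m * n) := [set v | forall k, `[(- b)%R, b]%classic (v ord0 k)].
have cQ : compact Q.
  by apply: (@rV_compact _ _ (fun=> `[(- b)%R, b]%classic)) => k; exact: segment_compact.
have cvec : continuous (@vec_mx R m n).
  apply: continuous_mx => i j.
  rewrite (_ : (fun _ => _) = (fun v : 'rV_(m * n) => v ord0 (mxvec_index i j))).
    exact: coord_continuous.
  by apply/funext => v; rewrite mxE.
apply: (subclosed_compact cA (continuous_compact (continuous_subspaceT cvec) cQ)).
move=> M AM; exists (mxvec M); last exact: mxvecK.
move=> k /=; case/mxvec_indexP: k => i j; rewrite mxvecE in_itv/= -ler_norml.
exact: bA.
Qed.

End MatrixTopology.

(** * Borel measurability and the support of a measure *)

Section Borel.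
Context {R : realType}.

Lemma open_borel {T : ptopologicalType} (A : set T) :
  open A -> measurable (A : set (borel T)).
Proof. exact: sub_gen_smallest. Qed.

Lemma lsc_borel {T : ptopologicalType} (f : T -> \bar R) :
  lower_semicontinuous f -> measurable_fun [set: borel T] f.
Proof.
move=> /lower_semicontinuousP lf.
apply: (measurability _ (ErealGenOInfty.measurableE R)).
move=> /= _ [_ [a ->]] <-; rewrite setTI preimage_itvoy; exact: open_borel.
Qed.

Lemma continuous_borel {T : ptopologicalType} (f : T -> R) :
  continuous f -> measurable_fun [set: borel T] f.
Proof.
move=> /continuousP cf.
apply: (measurability _ (RGenOInfty.measurableE R)).
move=> /= _ [_ [a ->]] <-; rewrite setTI; apply: open_borel; apply: cf.
rewrite -(_ : [set x | (a < x)%R] = `]a, +oo[%classic); first exact: open_gt.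
by rewrite set_itvoy.
Qed.

(** An open set is a countable union of rational boxes, and membership of f in a
    box is a finite conjunction of conditions on the entries of f.  This holds
    for any sigma-algebra on the source, in particular for a product of Borel
    sigma-algebras. *)
Lemma measurable_fun_mx d (T : measurableType d) (m n : nat)
    (f : T -> 'M[R]_(m, n)) :
  (forall i j, measurable_fun setT (fun t => f t i j)) ->
  measurable_fun (U := borel 'M[R]_(m, n)) setT f.
Proof.
move=> mf.
apply: (@measurability _ _ _ (borel 'M[R]_(m, n)) setT f
  (@open 'M[R]_(m, n))) => //.
move=> _ [U oU <-]; rewrite setTI (open_bigcup_rat_box oU) preimage_bigcup.
rewrite bigcup_mkcond; apply: countable_bigcupT_measurable => // p.
case: ifP => // _.
have -> : f @^-1` rat_box p = \bigcap_(i in [set: 'I_m]) \bigcap_(j in [set: 'I_n])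
    [set t | (`|ratr (p.1 i j) - f t i j| < p.2.+1%:R^-1)%R].
  apply/seteqP; split=> [t ft i _ j _|t ft i j]; first exact: ft.
  exact: ft.
apply: fin_bigcap_measurable => // i _; apply: fin_bigcap_measurable => // j _.
have mg : measurable_fun setT (fun t => `|ratr (p.1 i j) - f t i j|)%R.
  by apply: measurableT_comp => //; apply: measurable_funB.
have := mg measurableT `]-oo, (p.2.+1%:R^-1)%R[%classic (measurable_itv _).
by rewrite setTI; congr measurable; apply/seteqP; split=> t /=; rewrite in_itv.
Qed.

(** The complement of the support is an uncountable union of null open sets, but
    each of its points lies in a null rational box, and there are countably many
    of these. *)
Lemma supp_measure_full (n : nat) (mu : probability (borel 'cV[R]_n) R) :
  mu (supp_measure mu) = 1.
Proof.
have cS : open (~` supp_measure mu).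
  by rewrite /supp_measure setCK; apply: bigcup_open => U [].
suff /measure_negligible S0 : mu.-negligible (~` supp_measure mu).
  rewrite -[supp_measure mu]setCK probability_setC ?S0 ?sube0//; exact: open_borel.
pose F k : set (borel 'cV[R]_n) := if unpickle k is Some p then
  if `[< mu (rat_box p) = 0 >] then rat_box p else set0 else set0.
apply: (@negligibleS _ _ _ mu (\bigcup_k F k)); last first.
  apply: negligible_bigcup => k; rewrite /F.
  case: unpickle => [p|]; last exact: negligible_set0.
  case: asboolP => p0; last exact: negligible_set0.
  by apply/negligibleP => //; apply: open_borel; exact: open_rat_box.
rewrite /supp_measure setCK => x [U [oU U0] Ux].
have [p [px pU]] := nbhs_rat_box (open_nbhs_nbhs (conj oU Ux)).
exists (pickle p) => //; rewrite /F pickleK ifT//; apply/asboolP.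
apply/eqP; rewrite eq_le measure_ge0 andbT -U0 le_measure// inE.
  by apply: open_borel; exact: open_rat_box.
exact: open_borel.
Qed.

Lemma measurable_supp_measure (n : nat) (mu : probability (borel 'cV[R]_n) R) :
  measurable (supp_measure mu : set (borel 'cV[R]_n)).
Proof.
apply: measurableC; apply: open_borel.
by apply: bigcup_open => U [].
Qed.

End Borel.

(** * Lower semicontinuous functions *)

Section LowerSemicontinuous.
Context {R : realType}.

Lemma lee_real_below (x y : \bar R) :
  (forall a : R, a%:E < x -> a%:E <= y) -> x <= y.
Proof.
case: x => [x| |] xy; last by rewrite leNye.
- case: y xy => [y| |] xy; rewrite ?leey//; last first.
    by have := xy (x - 1)%R; rewrite lte_fin ltrBlDr ltrDl ltr01 => /(_ isT).
  rewrite leNgt; apply/negP; rewrite lte_fin => yx.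
  have : (((x + y) / 2)%R)%:E <= y%:E by apply: xy; rewrite lte_fin; lra.
  by rewrite lee_fin; lra.
- case: y xy => [y| |] xy; rewrite ?leey//.
    by have := xy (y + 1)%R (ltry _); rewrite lee_fin gerDl ler10.
  by have := xy 0%R (ltry _).
Qed.

Lemma lsc_comp (X Y : topologicalType) (f : Y -> \bar R) (g : X -> Y) :
  lower_semicontinuous f -> continuous g ->
  lower_semicontinuous (fun x => f (g x)).
Proof.
move=> lf cg x a /lf[V xV aV]; exists (g @^-1` V); first exact: cg.
by move=> y; exact: aV.
Qed.

Lemma lsc_le_limn_einf (X : topologicalType) (f : X -> \bar R) (u : nat -> X) x :
  lower_semicontinuous f -> u @ \oo --> x -> f x <= limn_einf (f \o u).
Proof.
move=> lf ux; apply: lee_real_below => a /lf[V xV aV].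
rewrite limn_einf_lim (cvg_lim _ (@cvg_einfs_sup _ _))//.
have [N _ uN] := ux _ xV.
apply: le_ereal_sup_tmp; exists (einfs (f \o u) N); first by exists N.
by apply: le_ereal_inf_tmp => _ [k /= Nk <-]; apply/ltW/aV/uN.
Qed.

(** If the integral took values at most a arbitrarily close to a point where it
    exceeds a, it would do so along a sequence converging to that point, against
    Fatou's lemma. *)
Lemma lsc_integral (X : pseudoMetricType R) d (Y : measurableType d)
    (mu : {measure set Y -> \bar R}) (F : X -> Y -> \bar R) :
  (forall x, measurable_fun setT (F x)) -> (forall x y, 0 <= F x y) ->
  (forall y, lower_semicontinuous (F^~ y)) ->
  lower_semicontinuous (fun x => \int[mu]_y F x y).
Proof.
move=> mF F0 lF x a ax; apply: contrapT => noV.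
have ex k : exists z, ball x k.+1%:R^-1 z /\ \int[mu]_y F z y <= a%:E.
  apply: contrapT => noz; apply: noV; exists (ball x k.+1%:R^-1).
    by apply: nbhsx_ballx; rewrite invr_gt0.
  by move=> z xz; rewrite ltNge; apply/negP => za; apply: noz; exists z.
have [z zP] := choice ex.
have zx : z @ \oo --> x.
  apply/cvg_ballP => e e0; near=> k; apply: (@le_ball _ _ _ k.+1%:R^-1); last first.
    exact: (zP k).1.
  by apply/ltW; near: k; exact: near_infty_natSinv_lt (PosNum e0).
move: ax; rewrite ltNge => /negP; apply.
apply: (@le_trans _ _ (\int[mu]_y limn_einf (fun k => F (z k) y))).
  apply: ge0_le_integral => //.
    (* measurability of the limit inferior, through that of a limit superior *)
    rewrite (_ : (fun _ => _) =
        \- (fun y => limn_esup (fun k => - F (z k) y))).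
      by apply: measurableT_comp => //; apply: measurable_fun_limn_esup => k;
        exact: measurableT_comp.
    apply/funext => y; rewrite -limn_einfN; congr limn_einf.
    by apply/funext => k /=; rewrite oppeK.
  by move=> y _; exact: (@lsc_le_limn_einf X (F^~ y) z x (lF y) zx).
apply: (le_trans (fatou _ _ _ _)) => //.
rewrite limn_einf_lim; apply: lime_le; first exact: is_cvg_einfs.
apply: nearW => k; apply: le_trans (zP k).2.
by apply: ereal_inf_lbound; exists k => /=.
Unshelve. all: by end_near. Qed.

(** The sublevel sets S x of f through the points x of K are totally ordered by
    inclusion, so they generate a proper filter.  By lower semicontinuity, f is
    minimal at any cluster point of it in K. *)
Lemma lsc_compact_min (X : topologicalType) (f : X -> \bar R) (K : set X) :
  compact K -> K !=set0 -> lower_semicontinuous f ->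
  exists2 x, K x & forall y, K y -> f x <= f y.
Proof.
move=> cK [x0 Kx0] lf.
pose S x := K `&` [set y | f y <= f x].
have fS : Filter (filter_from K S).
  apply: filter_from_filter; first by exists x0.
  move=> x y Kx Ky; have [xy|/ltW yx] := leP (f x) (f y).
    by exists x => // z [Kz zx]; do 2 split => //; exact: le_trans xy.
  by exists y => // z [Kz zx]; do 2 split => //; exact: le_trans yx.
have pS : ProperFilter (filter_from K S).
  by apply: filter_from_proper => x Kx; exists x; split => /=.
have [|x [Kx clx]] := cK _ pS; first by exists x0 => // y [].
exists x => // y Ky; apply: lee_real_below => a /lf[V xV aV].
have [|z [[_ /= zy] Vz]] := clx (S y) V _ xV; first by exists y.
exact: le_trans (ltW (aV _ Vz)) zy.
Qed.

End LowerSemicontinuous.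

(** * Integrals of functions that are almost surely bounded below *)

Section Truncation.
Context {R : realType}.

(** Where f >= - c this is just f + c; the positive part keeps it nonnegative
    elsewhere too, without losing lower semicontinuity. *)
Definition shift_pos T (c : R) (f : T -> \bar R) (x : T) := maxe (f x + c%:E) 0.

Lemma shift_pos_ge0 T c (f : T -> \bar R) x : 0 <= shift_pos c f x.
Proof. by rewrite le_max lexx orbT. Qed.

Lemma shift_posE T c (f : T -> \bar R) x :
  (- c)%:E <= f x -> shift_pos c f x = f x + c%:E.
Proof.
move=> cf; rewrite /shift_pos; apply/max_idPl.
by rewrite -leeBlDr// sub0e -EFinN.
Qed.

Lemma measurable_shift_pos d (T : measurableType d) c (f : T -> \bar R) :
  measurable_fun setT f -> measurable_fun setT (shift_pos c f).
Proof.
move=> mf; apply: measurable_maxe => //.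
by apply: emeasurable_funD.
Qed.

Lemma lsc_shift_pos (X : topologicalType) c (f : X -> \bar R) :
  lower_semicontinuous f -> lower_semicontinuous (shift_pos c f).
Proof.
move=> lf x a; rewrite lt_max => /orP[|a0]; last first.
  exists setT; first exact: filterT.
  by move=> y _; rewrite lt_max a0 orbT.
rewrite -lteBlDr// -EFinB => /lf[V xV aV]; exists V => // y /aV.
by rewrite EFinB lteBlDr// lt_max => ->.
Qed.

Lemma integral_full d (T : measurableType d) (P : probability T R) (D E : set T)
    (f : T -> \bar R) : measurable D -> measurable E -> P D = 1 -> D `<=` E ->
  measurable_fun setT f -> \int[P]_(x in E) f x = \int[P]_(x in D) f x.
Proof.
move=> mD mE PD DE mf.
have ED : E `\` ~` D = D by rewrite setDE setCK; exact/setIidr.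
have PN : P (~` D) = 0 by rewrite probability_setC// PD subee.
rewrite !(integralE P _ f) -[in RHS]ED; congr (_ - _);
  apply: ge0_negligible_integral => //; try exact: measurableC.
- by apply: measurable_funepos; exact: measurable_funTS.
- by apply: measurable_funeneg; exact: measurable_funTS.
Qed.

(** Both sides are integrals over D.  There, shift_pos c f + f^- = f^+ + c is an
    identity between sums of nonnegative functions, and the integral of f^- is at
    most c, so it can be moved to the other side even if f is not integrable. *)
Lemma integral_shift_pos d (T : measurableType d) (P : probability T R)
    (D E : set T) (f : T -> \bar R) (c : R) :
  measurable D -> measurable E -> P D = 1 -> D `<=` E -> measurable_fun setT f ->
  (0 <= c)%R -> (forall x, D x -> (- c)%:E <= f x) ->
  \int[P]_(x in E) f x = \int[P]_x shift_pos c f x - c%:E.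
Proof.
move=> mD mE PD DE mf c0 cf.
rewrite (integral_full mD mE PD DE mf).
rewrite [X in _ = X - _](integral_full mD _ PD _ _)//; last first.
  exact: measurable_shift_pos.
have cD : \int[P]_(x in D) c%:E = c%:E.
  by rewrite integral_cst//= [X in _ * X]PD mule1.
have mfp : measurable_fun D f^\+.
  by apply: measurable_funepos; exact: measurable_funTS.
have mfn : measurable_fun D f^\- .
  by apply: measurable_funeneg; exact: measurable_funTS.
have qc : \int[P]_(x in D) f^\- x <= c%:E.
  rewrite -[leRHS]cD; apply: ge0_le_integral => // x Dx.
  by rewrite funenegE ge_max lee_fin c0 andbT leeNl -EFinN cf.
have E1 : \int[P]_(x in D) shift_pos c f x + \int[P]_(x in D) f^\- x =
    \int[P]_(x in D) f^\+ x + c%:E.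
  rewrite -[in RHS]cD -!ge0_integralD//; last 2 first.
  - by move=> x _; exact: shift_pos_ge0.
  - by apply: measurable_funTS; exact: measurable_shift_pos.
  apply: eq_integral => x; rewrite inE => Dx; rewrite shift_posE ?cf//.
  have := cf x Dx; rewrite funeposE funenegE; case: (f x) => [r _|_|//] /=; last first.
    by rewrite max_r ?leNye// max_l ?leey.
  rewrite -!EFin_max -!EFinD; congr EFin.
  case: (ltP r 0%R) => r0; [rewrite max_l ?max_r|rewrite max_r ?max_l]; lra.
rewrite integralE.
have qfin : \int[P]_(x in D) f^\- x \is a fin_num.
  rewrite ge0_fin_numE; first exact: le_lt_trans qc (ltry _).
  by apply: integral_ge0.
have -> : \int[P]_(x in D) shift_pos c f x =
    \int[P]_(x in D) f^\+ x + c%:E - \int[P]_(x in D) f^\- x.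
  by rewrite -E1 addeK.
by rewrite addeAC addeK.
Qed.

End Truncation.

(** * The orthogonal groups are compact *)

Section Orthogonal.
Context {R : realType} {n : nat}.
Implicit Types (theta : 'M[R]_n) (x y : 'cV[R]_n).

Lemma dotvE x y : dotv x y = (x^T *m y)%R ord0 ord0.
Proof. by rewrite mxE; apply: eq_bigr => i _; rewrite mxE. Qed.

Lemma dotv_mulmxl (A : 'M[R]_n) x y : (dotv (A^T *m x) y = dotv x (A *m y))%R.
Proof. by rewrite !dotvE trmx_mul trmxK mulmxA. Qed.

Lemma orthogonal_mulmxT theta : O_ n theta -> (theta *m theta^T = 1%:M)%R.
Proof. exact: mulmx1C. Qed.

Lemma orthogonal_invmx theta : O_ n theta -> (invmx theta = theta^T)%R.
Proof.
move=> oth; have [_ uth] := mulmx1_unit oth.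
by rewrite -[invmx theta]mul1mx -oth -mulmxA mulmxV// mulmx1.
Qed.

Lemma dotv_orthogonal theta y : O_ n theta ->
  (dotv (theta^T *m y) (theta^T *m y) = dotv y y)%R.
Proof. by move=> oth; rewrite dotv_mulmxl mulmxA orthogonal_mulmxT// mul1mx. Qed.

Lemma dotv_ge0 x : (0 <= dotv x x)%R.
Proof. by apply: sumr_ge0 => i _; rewrite -expr2 sqr_ge0. Qed.

(** The difference of the two sides is a sum of terms a^2 + b^2 + a b.  This
    weak form of the Cauchy-Schwarz inequality involves no square root. *)
Lemma dotv_ge x y : (- (dotv x x + dotv y y) <= dotv x y)%R.
Proof.
rewrite -subr_ge0 opprK /dotv -!big_split/=; apply: sumr_ge0 => i _; nra.
Qed.

Lemma continuous_mulr (T : topologicalType) (f g : T -> R) :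
  continuous f -> continuous g -> continuous (fun t => f t * g t)%R.
Proof. by move=> cf cg t; apply: cvgM; [exact: cf|exact: cg]. Qed.

Lemma continuous_sumr (T : topologicalType) (I : Type) (r : seq I)
    (f : I -> T -> R) : (forall i, continuous (f i)) ->
  continuous (fun t => \sum_(i <- r) f i t)%R.
Proof.
move=> cf t; elim: r => [|i r IHr].
  by under eq_fun do rewrite big_nil; exact: cvg_cst.
by under eq_fun do rewrite big_cons; apply: cvgD => //; exact: cf.
Qed.

Lemma continuous_prodr (T : topologicalType) (I : Type) (r : seq I)
    (f : I -> T -> R) : (forall i, continuous (f i)) ->
  continuous (fun t => \prod_(i <- r) f i t)%R.
Proof.
move=> cf t; elim: r => [|i r IHr].
  by under eq_fun do rewrite big_nil; exact: cvg_cst.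
by under eq_fun do rewrite big_cons; apply: cvgM => //; exact: cf.
Qed.

Lemma continuous_mulmx (T : topologicalType) (m p q : nat)
    (A : T -> 'M[R]_(m, p)) (B : T -> 'M[R]_(p, q)) :
  (forall i j, continuous (fun t => A t i j)) ->
  (forall i j, continuous (fun t => B t i j)) ->
  continuous (fun t => A t *m B t)%R.
Proof.
move=> cA cB; apply: continuous_mx => i j.
under eq_fun do rewrite mxE.
by apply: continuous_sumr => k; exact: continuous_mulr.
Qed.

Lemma continuous_trmx_mul y : continuous (fun theta => theta^T *m y)%R.
Proof.
apply: continuous_mulmx => i j; last exact: cst_continuous.
by under eq_fun do rewrite mxE; exact: coord_continuous.
Qed.

Lemma continuous_mulmxl (A : 'M[R]_n) :
  continuous (fun y : 'cV[R]_n => A *m y)%R.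
Proof.
apply: continuous_mulmx => i j; first exact: cst_continuous.
exact: coord_continuous.
Qed.

Lemma continuous_det : continuous (fun theta => \det theta)%R.
Proof.
apply: continuous_sumr => s; apply: continuous_mulr; first exact: cst_continuous.
by apply: continuous_prodr => i; exact: coord_continuous.
Qed.

Lemma closed_O : closed (O_ n : set 'M[R]_n).
Proof.
have cf : continuous (fun theta => theta^T *m theta)%R.
  apply: continuous_mulmx => i j; last exact: coord_continuous.
  by under eq_fun do rewrite mxE; exact: coord_continuous.
rewrite (_ : O_ n = (fun theta => theta^T *m theta)%R @^-1` [set 1%:M]) //.
apply: closed_comp; first by move=> theta _; exact: cf.
apply: accessible_closed_set1; apply: hausdorff_accessible.
exact: norm_hausdorff.
Qed.

Lemma closed_SO : closed (SO_ n : set 'M[R]_n).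
Proof.
apply: closedI; first exact: closed_O.
apply: (@closed_comp _ _ (fun theta => \det theta)%R [set 1%R]).
  by move=> theta _; exact: continuous_det.
exact: closed_eq.
Qed.

(** The columns of theta are unit vectors. *)
Lemma orthogonal_entry_le1 theta : O_ n theta -> forall i j, (`|theta i j| <= 1)%R.
Proof.
move=> oth i j; rewrite -(@expr_le1 _ 2%N)// real_normK ?num_real//.
have /matrixP/(_ j j) : (theta^T *m theta = 1%:M)%R by [].
rewrite !mxE eqxx (bigD1 i)//= !mxE mulr1n => <-.
rewrite -expr2 lerDl; apply: sumr_ge0 => k _.
by rewrite !mxE -expr2 sqr_ge0.
Qed.

Lemma closed_orthogonal_compact (K : set 'M[R]_n) :
  K `<=` O_ n -> closed K -> compact K.
Proof.
move=> KO cK; apply: (bounded_entries_compact (b := 1%R) cK) => theta Kth.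
exact/orthogonal_entry_le1/KO.
Qed.

End Orthogonal.

(** * Legendre transforms *)

Section Legendre.
Context {R : realType} {n : nat}.
Implicit Types (psi : 'cV[R]_n -> \bar R) (x y : 'cV[R]_n).

Lemma legendre_rotate_fun (theta : 'M[R]_n) psi x : O_ n theta ->
  legendre (rotate_fun theta psi) x = legendre psi (theta^T *m x)%R.
Proof.
move=> oth; rewrite /legendre /rotate_fun orthogonal_invmx//.
congr ereal_sup; apply/seteqP; split=> _ [y _ <-].
  exists (theta^T *m y)%R => //.
  by rewrite dotv_mulmxl mulmxA orthogonal_mulmxT// mul1mx.
exists (theta *m y)%R => //.
by rewrite mulmxA oth mul1mx dotv_mulmxl.
Qed.

Lemma continuous_dotv y : continuous (fun x => dotv x y).
Proof.
apply: continuous_sumr => i; apply: continuous_mulr; last exact: cst_continuous.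
exact: coord_continuous.
Qed.

(** A strict lower bound on a supremum is witnessed by one of its terms, which is
    continuous in the point where the transform is evaluated. *)
Lemma lsc_legendre psi : lower_semicontinuous (legendre psi).
Proof.
move=> x a /ereal_sup_gtP[_ [y _ <-] axy].
have up z : a%:E < (dotv z y)%:E - psi y -> a%:E < legendre psi z.
  by move=> h; apply/ereal_sup_gtP; exists ((dotv z y)%:E - psi y) => //; exists y.
case Ey : (psi y) axy up => [r| |] axy up; last 1 first.
- by exists setT; [exact: filterT|move=> z _; apply: up; rewrite ltry].
- exists [set z | (a + r < dotv z y)%R].
    apply: open_nbhs_nbhs; split; last by move: axy; rewrite -EFinB lte_fin /= ltrBrDr.
    apply: (@open_comp _ _ (fun z => dotv z y) [set t | (a + r < t)%R]).
      by move=> z _; exact: continuous_dotv.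
    exact: open_gt.
  by move=> z /= az; apply: up; rewrite -EFinB lte_fin ltrBrDr.
- by [].
Qed.

(** Any y with psi y finite gives an affine minorant, and [dotv_ge] bounds that
    minorant below by a function of dotv x x alone. *)
Lemma legendre_lower_bound psi : proper_fun psi ->
  exists c : R, forall x, (- (dotv x x + c))%:E <= legendre psi x.
Proof.
move=> [psiNy [y psiy]].
have psify : psi y \is a fin_num by rewrite fin_numElt psiNy.
exists (dotv y y + fine (psi y))%R => x.
apply: le_ereal_sup_tmp; exists ((dotv x y)%:E - psi y); first by exists y.
rewrite -(fineK psify) -EFinB lee_fin addrA opprD lerD2r.
exact: dotv_ge.
Qed.

End Legendre.

(** * Averages over rotations *)

Section Average.
Context {R : realType} {n : nat}.
Variables (mu : probability (borel 'cV[R]_n) R) (psi : 'cV[R]_n -> \bar R).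

(** One constant serves all rotations, so that the values for different rotations
    differ from their shifted versions by the same amount. *)
Definition orbit_bound (c : R) := (0 <= c)%R /\
  forall (theta : 'M[R]_n) y, O_ n theta -> supp_measure mu y ->
    (- c)%:E <= legendre psi (theta^T *m y)%R.

Definition shifted_avg (c : R) (theta : 'M[R]_n) : \bar R :=
  \int[mu]_y shift_pos c (legendre psi) (theta^T *m y)%R.

Lemma exists_orbit_bound : proper_fun psi -> supp_radius mu < +oo ->
  exists c, orbit_bound c.
Proof.
move=> /legendre_lower_bound[c uc] radlt.
have [b yb] : exists b : R, forall y, supp_measure mu y -> (dotv y y <= b)%R.
  have ub y : supp_measure mu y -> (enorm y)%:E <= supp_radius mu.
    by move=> Sy; apply: ereal_sup_ubound; exists y.
  case E : (supp_radius mu) radlt ub => [r| |] // _ ub.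
  - exists (r ^+ 2)%R => y /ub; rewrite lee_fin => yr.
    have y0 : (0 <= enorm y)%R := sqrtr_ge0 _.
    by rewrite -(sqr_sqrtr (dotv_ge0 y)) ler_sqr ?nnegrE// (le_trans y0).
  - by exists 0%R => y /ub; rewrite leeNy_eq.
exists (Num.max 0 (b + c))%R; split=> [|theta y oth Sy]; first by rewrite le_max lexx.
apply: le_trans (uc _); rewrite lee_fin lerN2 dotv_orthogonal//.
by rewrite le_max lerD2r yb ?orbT.
Qed.

Variable c : R.
Hypothesis cB : orbit_bound c.

Let c0 : (0 <= c)%R. Proof. by case: cB. Qed.

Lemma Phi_avg_rotate_fun theta : O_ n theta ->
  Phi_avg (rotate_fun theta psi) mu = shifted_avg c theta - c%:E.
Proof.
move=> oth; rewrite /Phi_avg.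
under eq_integral do rewrite legendre_rotate_fun//.
apply: (integral_shift_pos (measurable_supp_measure mu) measurableT
  (supp_measure_full mu)) => //.
  apply: lsc_borel; apply: lsc_comp; [exact: lsc_legendre|].
  exact: continuous_mulmxl.
by move=> y Sy; exact: cB.2.
Qed.

Lemma lsc_shifted_avg : lower_semicontinuous (shifted_avg c).
Proof.
apply: lsc_integral => [theta|theta y|y]; last 2 first.
- exact: shift_pos_ge0.
- apply: lsc_comp; [exact/lsc_shift_pos/lsc_legendre|exact: continuous_trmx_mul].
apply: lsc_borel; apply: lsc_comp; [exact/lsc_shift_pos/lsc_legendre|].
exact: continuous_mulmxl.
Qed.

(** The bounds on g also bound the transform of phi below by - c on the support of
    mu, so its integral can be shifted in turn. *)
Lemma Phi_avg_ge (phi : 'cV[R]_n -> \bar R) (g : 'cV[R]_n -> \bar R) :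
  measurable_fun [set: borel 'cV[R]_n] g -> (forall y, 0 <= g y) ->
  (forall y, supp_measure mu y -> g y - c%:E <= legendre phi y) ->
  \int[mu]_y g y - c%:E <= Phi_avg phi mu.
Proof.
move=> mg g0 gphi.
have mS := measurable_supp_measure mu; have muS := supp_measure_full mu.
have mphi : measurable_fun [set: borel 'cV[R]_n] (legendre phi).
  by apply: lsc_borel; exact: lsc_legendre.
rewrite /Phi_avg [leRHS](integral_shift_pos mS measurableT muS (c := c))//; last first.
  move=> y Sy; apply: le_trans (gphi y Sy).
  by rewrite EFinN leeDr.
rewrite leeD2r// [leLHS](integral_full mS _ muS)// [leRHS](integral_full mS _ muS)//; last first.
  exact: measurable_shift_pos.
apply: ge0_le_integral => //.
- exact: measurable_funTS.
- by apply: measurable_funTS; exact: measurable_shift_pos.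
- by move=> y Sy; rewrite le_max -leeBlDr// gphi.
Qed.

Lemma exists_min_rotation (K : set 'M[R]_n) :
  K `<=` O_ n -> closed K -> K !=set0 ->
  exists theta_o, [/\ K theta_o,
    forall theta, K theta -> shifted_avg c theta_o <= shifted_avg c theta &
    forall theta, K theta ->
      Phi_avg (rotate_fun theta_o psi) mu <= Phi_avg (rotate_fun theta psi) mu].
Proof.
move=> KO cK K0.
have [theta_o Ko mino] :=
  lsc_compact_min (closed_orthogonal_compact KO cK) K0 lsc_shifted_avg.
exists theta_o; split; [exact: Ko|exact: mino|move=> theta Kt].
rewrite (Phi_avg_rotate_fun (KO _ Ko)) (Phi_avg_rotate_fun (KO _ Kt)).
by apply: leeD2r; exact: mino.
Qed.

(** By Tonelli, the average of [shifted_avg] over nu is the integral over mu of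
    y |-> \int[nu]_theta w (theta^T y), with w the shifted transform of psi, and
    on the support of mu that function minus c is the transform of phi. *)
Lemma avg_rotation_le_Phi_avg (nu : probability (borel 'M[R]_n) R)
    (phi : 'cV[R]_n -> \bar R) (K : set 'M[R]_n) (theta_o : 'M[R]_n) :
  K `<=` O_ n -> closed K -> nu K = 1 ->
  (forall x, legendre phi x =
    \int[nu]_(theta in K) legendre psi (invmx theta *m x)%R) ->
  O_ n theta_o ->
  (forall theta, K theta -> shifted_avg c theta_o <= shifted_avg c theta) ->
  Phi_avg (rotate_fun theta_o psi) mu <= Phi_avg phi mu.
Proof.
move=> KO cK nuK Lphi Oo mino.
have mK : measurable (K : set (borel 'M[R]_n)).
  by rewrite -[K]setCK; apply: measurableC; apply: open_borel; exact: closed_openC.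
pose f (z : borel 'M[R]_n * borel 'cV[R]_n) : \bar R :=
  shift_pos c (legendre psi) (z.1^T *m z.2)%R.
have mf : measurable_fun setT f.
  apply: (@measurableT_comp _ _ _ _ (borel 'cV[R]_n) _ (shift_pos c (legendre psi)) _
    (fun z : borel 'M[R]_n * borel 'cV[R]_n => z.1^T *m z.2)%R).
    by apply: lsc_borel; exact/lsc_shift_pos/lsc_legendre.
  apply: measurable_fun_mx => i j; under eq_fun do rewrite mxE.
  apply: measurable_sum => k; apply: measurable_funM.
    under eq_fun do rewrite mxE.
    apply: (@measurableT_comp _ _ _ _ (borel 'M[R]_n) _ (fun M => M k i) _ fst) => //.
    by apply: continuous_borel; exact: coord_continuous.
  apply: (@measurableT_comp _ _ _ _ (borel 'cV[R]_n) _ (fun M => M k j) _ snd) => //.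
  by apply: continuous_borel; exact: coord_continuous.
have f0 z : 0 <= f z by exact: shift_pos_ge0.
rewrite Phi_avg_rotate_fun//.
pose g y := \int[nu]_theta f (theta, y).
apply: le_trans (Phi_avg_ge (phi := phi) (g := g) _ _ _).
- rewrite leeD2r// -fubini_tonelli//.
  have mJ : measurable_fun [set: borel 'M[R]_n] (shifted_avg c).
    by apply: lsc_borel; exact: lsc_shifted_avg.
  have -> : \int[nu]_theta \int[mu]_y f (theta, y) =
    \int[nu]_theta shifted_avg c theta by [].
  rewrite (integral_full mK _ nuK)//.
  have {1}-> : shifted_avg c theta_o =
      \int[nu]_(theta in K) (cst (shifted_avg c theta_o)) theta.
    by rewrite integral_cst//= [X in _ * X]nuK mule1.
  apply: ge0_le_integral.
  + exact: mK.
  + by move=> theta _; apply: integral_ge0 => y _; exact: shift_pos_ge0.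
  + exact: measurable_cst.
  + exact: measurable_funTS.
  + exact: mino.
- exact: measurable_fun_fubini_tonelli_G.
- by move=> y; exact: integral_ge0.
- move=> y Sy.
  pose h (theta : borel 'M[R]_n) : \bar R := legendre psi (theta^T *m y)%R.
  have -> : legendre phi y = \int[nu]_(theta in K) h theta.
    rewrite Lphi; apply: eq_integral => theta; rewrite inE => /KO oth.
    by rewrite /h orthogonal_invmx.
  rewrite (integral_shift_pos (c := c) mK mK nuK) => [//|//||//|theta /KO oth].
    apply: lsc_borel; apply: lsc_comp; first exact: lsc_legendre.
    exact: continuous_trmx_mul.
  exact: cB.2.
Qed.

End Average.

(** * Dimension one *)

Section Dimension1.
Context {R : realType}.
Implicit Types (psi : 'cV[R]_1 -> \bar R) (x : 'cV[R]_1).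

(** Testing the transform of the symmetrization at z = (a - b) / 2, and the
    infimal convolution at 2 z with the decomposition 2 z = a + (- b), gives half
    of the sum of the a-term of the transform of psi at x and of its b-term at
    - x; then take suprema over a and b separately. *)
Lemma legendre_epi_rot1_ge psi x : proper_fun psi ->
  2^-1%:E * (legendre psi x + legendre psi (- x)%R) <= legendre (epi_rot1 psi) x.
Proof.
move=> [psiNy [y0 psiy0]].
set M := legendre (epi_rot1 psi) x.
have key a b : ((dotv x a)%:E - psi a) + ((dotv (- x) b)%:E - psi b) <= 2%:E * M.
  case Ea : (psi a) (psiNy a) => [pa| |] // _; last by rewrite addNye leNye.
  case Eb : (psi b) (psiNy b) => [pb| |] // _; last by rewrite addeNy leNye.
  pose z : 'cV[R]_1 := (2^-1 *: (a - b))%R.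
  have inf_le : infconv psi (fun y => psi (- y)%R) (2%:R *: z)%R <= (pa + pb)%:E.
    apply: ereal_inf_lbound; exists (- b)%R => //.
    by rewrite /z scalerA divff// scale1r !opprK subrK Ea Eb.
  rewrite -lee_pdivrMl//; apply: (@le_trans _ _ ((dotv x z)%:E - epi_rot1 psi z)).
    apply: (@le_trans _ _ ((dotv x z)%:E - (2^-1 * (pa + pb))%:E)).
      rewrite -!EFinB -EFinD -EFinM lee_fin /dotv !big_ord1 !mxE; lra.
    by rewrite leeD2l// leeN2 EFinM lee_wpmul2l// lee_fin invr_ge0.
  by apply: ereal_sup_ubound; exists z.
have fin0 : psi y0 \is a fin_num by rewrite fin_numElt psiNy.
case: M key => [r| |] key; last 2 first.
- by rewrite leey.
- have := key y0 y0; rewrite -(fineK fin0) -!EFinB -EFinD.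
  by rewrite gt0_muleNy// leeNy_eq.
(* supremum over a for fixed b, then over b below *)
have bound b : (dotv (- x) b)%:E - psi b != -oo ->
    legendre psi x <= 2%:E * r%:E - ((dotv (- x) b)%:E - psi b).
  move=> Bb; apply: ge_ereal_sup => _ [a _ <-]; rewrite leeBrDr; first exact: key.
  rewrite fin_numE Bb/=.
  by case: (psi b) (psiNy b).
have ufin : legendre psi x \is a fin_num.
  rewrite fin_numElt; apply/andP; split.
    apply: (@lt_le_trans _ _ ((dotv x y0)%:E - psi y0)).
      by rewrite -(fineK fin0) -EFinB ltNyr.
    by apply: ereal_sup_ubound; exists y0.
  apply: le_lt_trans (bound y0 _) _.
    by rewrite -(fineK fin0) -EFinB.
  by rewrite -(fineK fin0) -EFinM -!EFinB ltry.
rewrite lee_pdivrMl// addeC -leeBrDr//; apply: ge_ereal_sup => _ [b _ <-].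
have [->|Bb] := eqVneq ((dotv (- x) b)%:E - psi b) -oo; first exact: leNye.
have Bfin : (dotv (- x) b)%:E - psi b \is a fin_num.
  by rewrite fin_numE Bb/=; case: (psi b) (psiNy b).
by rewrite leeBrDr// addeC -leeBrDr// bound.
Qed.

Lemma opprmx1_O n : O_ n (- 1%:M : 'M[R]_n)%R.
Proof.
by rewrite /O_/= [X in X *m _]linearN/= trmx1 mulmxN mulNmx mulmx1 opprK.
Qed.

Lemma mx1_O n : O_ n (1%:M : 'M[R]_n)%R.
Proof. by rewrite /O_/= trmx1 mulmx1. Qed.

(** The two elements of O(1) give J 1 + J (-1) >= 2 J theta_o, and half of that sum
    is the integral of the shifted average g of the transform of psi over the two
    reflections. *)
Lemma avg_reflection_le_Phi_avg (mu : probability (borel 'cV[R]_1) R) psi c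
    (theta_o : 'M[R]_1) : proper_fun psi -> orbit_bound mu psi c ->
  O_ 1 theta_o ->
  (forall theta, O_ 1 theta ->
    shifted_avg mu psi c theta_o <= shifted_avg mu psi c theta) ->
  Phi_avg (rotate_fun theta_o psi) mu <= Phi_avg (epi_rot1 psi) mu.
Proof.
move=> ppsi cB Oo mino.
pose w : 'cV[R]_1 -> \bar R := shift_pos c (legendre psi).
have mw (theta : 'M[R]_1) :
    measurable_fun [set: borel 'cV[R]_1] (fun y => w (theta^T *m y)%R).
  by apply: lsc_borel; apply: lsc_comp;
    [exact/lsc_shift_pos/lsc_legendre|exact: continuous_mulmxl].
pose g y := 2^-1%:E * (w ((1%:M)^T *m y)%R + w ((- 1%:M)^T *m y)%R).
have w0 y : 0 <= w y by exact: shift_pos_ge0.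
rewrite (Phi_avg_rotate_fun cB)//.
apply: le_trans (Phi_avg_ge cB (g := g) _ _ _).
+ rewrite leeD2r// ge0_integralZl//; last 2 first.
  * exact: (emeasurable_funD (mw _) (mw _)).
  * by move=> y _; rewrite adde_ge0.
  rewrite ge0_integralD//.
  have sum_ge : shifted_avg mu psi c theta_o + shifted_avg mu psi c theta_o <=
      shifted_avg mu psi c 1%:M + shifted_avg mu psi c (- 1%:M)%R.
    by apply: leeD; apply: mino; [exact: mx1_O|exact: opprmx1_O].
  rewrite lee_pdivlMl//; apply: le_trans sum_ge.
  by rewrite (mule_natl _ 2%N) mule2n.
+ by apply: measurable_funeM; exact: (emeasurable_funD (mw _) (mw _)).
+ by move=> y; rewrite mule_ge0 ?adde_ge0// lee_fin invr_ge0.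
+ move=> y Sy; apply: le_trans (legendre_epi_rot1_ge y ppsi).
  have wE (theta : 'M[R]_1) : O_ 1 theta ->
      w (theta^T *m y)%R = legendre psi (theta^T *m y)%R + c%:E.
    by move=> oth; rewrite /w shift_posE//; exact: cB.2.
  rewrite /g !wE; [|exact: opprmx1_O|exact: mx1_O].
  rewrite linearN/= trmx1 mulNmx mul1mx.
  case: (legendre psi y) => [a| |]; case: (legendre psi (- y)%R) => [b| |] /=;
    rewrite ?addNye ?addeNy ?addye ?addey ?gt0_muley ?gt0_muleNy
      ?addNye ?leNye ?leey//.
  by rewrite -?EFinB -!(EFinD, EFinM) lee_fin; lra.
Qed.

End Dimension1.

(** * Minimal rotations and the symmetrization *)

Unset Implicit Arguments.

Theorem corollary9p6 (R : realType) :
  (forall (n : nat) (mu : probability (borel 'cV[R]_n) R)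
      (psi : 'cV[R]_n -> \bar R),
    (2 <= n)%N -> compact (supp_measure mu) -> Conv_c psi -> supp_radius mu < dom_radius psi ->
    exists theta_o : 'M[R]_n,
      [/\ SO_ n theta_o,
          (forall theta : 'M[R]_n, SO_ n theta ->
             Phi_avg (rotate_fun theta_o psi) mu <= Phi_avg (rotate_fun theta psi) mu)
        & (forall (nu : probability (borel 'M[R]_n) R)
              (psi_rot : 'cV[R]_n -> \bar R),
             is_haar_SO nu -> is_epi_rot nu psi psi_rot ->
             Phi_avg (rotate_fun theta_o psi) mu <= Phi_avg psi_rot mu)])
  /\
  (forall (mu : probability (borel 'cV[R]_1) R) (psi : 'cV[R]_1 -> \bar R),
    compact (supp_measure mu) -> Conv_c psi -> supp_radius mu < dom_radius psi ->
    exists theta_o : 'M[R]_1,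
      [/\ O_ 1 theta_o,
          (forall theta : 'M[R]_1, O_ 1 theta ->
             Phi_avg (rotate_fun theta_o psi) mu <= Phi_avg (rotate_fun theta psi) mu)
        & Phi_avg (rotate_fun theta_o psi) mu <= Phi_avg (epi_rot1 psi) mu]).
Proof.
have ltoo (a b : \bar R) : a < b -> a < +oo.
  by move=> ab; exact: lt_le_trans ab (leey _).
split=> [n mu psi _ _ [_ ppsi _ _] /ltoo rad|mu psi _ [_ ppsi _ _] /ltoo rad].
- have [c cB] := exists_orbit_bound ppsi rad.
  have SOO : SO_ n `<=` (O_ n : set 'M[R]_n) by move=> theta [].
  have SO0 : (SO_ n : set 'M[R]_n) !=set0.
    by exists 1%:M%R; split; [exact: mx1_O|exact: det1].
  have [theta_o [SOo mino mino']] := exists_min_rotation cB SOO closed_SO SO0.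
  exists theta_o; split; [exact: SOo|exact: mino'|].
  move=> nu psi_rot [nuSO _] [_ Lrot].
  exact: (avg_rotation_le_Phi_avg cB SOO closed_SO nuSO Lrot (SOO _ SOo) mino).
- have [c cB] := exists_orbit_bound ppsi rad.
  have OO : O_ 1 `<=` (O_ 1 : set 'M[R]_1) by [].
  have O0 : (O_ 1 : set 'M[R]_1) !=set0 by exists 1%:M%R; exact: mx1_O.
  have [theta_o [Oo mino mino']] := exists_min_rotation cB OO closed_O O0.
  exists theta_o; split; [exact: Oo|exact: mino'|].
  exact: (avg_reflection_le_Phi_avg ppsi cB Oo mino).
Qed.
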